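(* Let $N$ be an even positive integer, let $R>0$ be a real number, let $A(0),A(1),\dots,A(N/2-1)$ be complex numbers, and let $$J(\tau)=\sum_{u=0}^{N/2-1}\Bigl|A(u)+R\exp\bigl(j\tfrac{2\pi}{N}\tau u\bigr)\Bigr|^2,\qquad \tau=1,\dots,N.$$ Then $$A(u)=\frac1{NR}\sum_{\tau=1}^{N}J(\tau)\exp\bigl(j\tfrac{2\pi}{N}\tau u\bigr),\qquad 0<u\le N/2-1,$$ $$|A(0)+R|^2=\frac1N\sum_{\tau=1}^{N}J(\tau)-\Bigl(\sum_{u_1=1}^{N/2-1}|A(u_1)|^2+\sum_{u_1=1}^{N/2-1}R^2\Bigr).$$ Moreover, let $$a(u)=\mathrm{IFFT}(J)(u)\cdot\exp\bigl(j\tfrac{2\pi}{N}(u-1)\bigr),\qquad u=1,\dots,N,$$ where $\mathrm{IFFT}$ is applied to the sequence $(J(1),\dots,J(N))$. Then $$A(u)=\frac1R\,a(u+1),\qquad u=1,\dots,N/2-1,$$ $$|A(0)+R|^2=\frac1N\sum_{\tau=1}^{N}J(\tau)-\Bigl(\sum_{u_1=1}^{N/2-1}|A(u_1)|^2+\sum_{u_1=1}^{N/2-1}R^2\Bigr).$$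
   Context: Here $j$ is the imaginary unit. For a sequence $y=(y_1,\dots,y_N)$ of complex numbers, the inverse FFT (MATLAB convention) is the sequence indexed by $u=1,\dots,N$ given by $$\mathrm{IFFT}(y)(u)=\frac1N\sum_{k=1}^{N}y_k\exp\bigl(j\tfrac{2\pi}{N}(k-1)(u-1)\bigr).$$ *)

(* Defs.v *)
From mathcomp Require Import all_boot all_order all_algebra.
From mathcomp Require Import complex.
From mathcomp Require Import all_classical all_reals all_analysis.

Set Implicit Arguments.
Unset Strict Implicit.
Unset Printing Implicit Defensive.

Import Order.TTheory GRing.Theory Num.Theory.

Local Open Scope ring_scope.
Local Open Scope complex_scope.

Definition cexp (K : realType) (z : K[i]) : K[i] :=
  (expR (complex.Re z) * cos (complex.Im z))
    +i* (expR (complex.Re z) * sin (complex.Im z)).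

(* Sequences y_1, ..., y_N are functions on nat, only read at 1 <= k <= N; the
   value is meant for 1 <= u <= N. The differences k - 1 and u - 1 are taken
   in K[i], not in nat. *)
Definition IFFT (K : realType) (N : nat) (y : nat -> K[i]) (u : nat) : K[i] :=
  (N%:R)^-1 * \sum_(1 <= k < N.+1)
    y k * cexp ('i%C * (2 * pi / N%:R)%:C * (k%:R - 1) * (u%:R - 1)).

(* Main.v *)
Require Import Defs.
From mathcomp Require Import all_boot all_order all_algebra.
From mathcomp Require Import complex.
From mathcomp Require Import all_classical all_reals all_analysis.
From mathcomp Require Import ring lra zify.

Import Order.TTheory GRing.Theory Num.Theory.

Local Open Scope ring_scope.
Local Open Scope complex_scope.

(** Write [z] for the primitive [N]-th root of unity [exp (2 pi i / N)], so that
    every exponential in the statement is a power of [z].  Expanding the square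
    gives
      [|A v + R z^(tau v)|^2
         = |A v|^2 + R^2 + R A v z^(- tau v) + R (A v)^* z^(tau v)],
    so [J] is a trigonometric polynomial with [R A v] at frequency [-v] and
    [R (A v)^*] at frequency [v].  Multiplying by [z^(tau u)] and summing over a
    full period [tau = 1 .. N] keeps only the terms of frequency divisible by
    [N] ([sum_prim_root_expr]).  For [0 <= u, v < N / 2] the sum [u + v] lies in
    [0, N) and the difference [u - v] in (- N / 2, N / 2), so the half-range of
    [v] prevents aliasing between the two families: [u > 0] isolates [R A u],
    while [u = 0] collects the mean square terms together with the two cross
    terms of [v = 0] ([sum_sqr_norm_prim_root]).  The IFFT form is the same sum:
    its frequency shift [(k - 1) u] is undone by the extra factor
    [exp (2 pi i u / N)] in [a]. *)

Lemma sum_prim_root_expr (C : fieldType) (N : nat) (z : C) (k : nat) :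
  N.-primitive_root z ->
  \sum_(1 <= t < N.+1) z ^+ (t * k) = if (N %| k)%N then N%:R else 0.
Proof.
move=> zP; have zkN1 : (z ^+ k) ^+ N = 1.
  by rewrite -exprM mulnC exprM (prim_expr_order zP) expr1n.
have -> : \sum_(1 <= t < N.+1) z ^+ (t * k) = z ^+ k * \sum_(i < N) (z ^+ k) ^+ i.
  rewrite big_add1 /= big_mkord mulr_sumr.
  by apply: eq_bigr => i _; rewrite -exprS -exprM mulnC.
rewrite (prim_order_dvd zP); case: eqP => [->|/eqP zk_neq1].
  under eq_bigr do rewrite expr1n.
  by rewrite mul1r sumr_const card_ord.
(* the geometric sum telescopes after multiplication by z ^+ k - 1 *)
have /esym/eqP := subrX1 (z ^+ k) N.
by rewrite zkN1 subrr mulf_eq0 subr_eq0 (negPf zk_neq1) => /eqP ->; rewrite mulr0.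
Qed.

(** The frequency [- v] of the conjugate is represented by [N - v], which keeps
    all exponents natural numbers. *)
Lemma conj_prim_root_expr (C : numClosedFieldType) (N : nat) (z : C) (t v : nat) :
  N.-primitive_root z -> (v <= N)%N -> Num.conj (z ^+ (t * v)) = z ^+ (t * (N - v)).
Proof.
move=> zP vN.
have zN1 : z ^+ (t * N) = 1 by rewrite mulnC exprM (prim_expr_order zP) expr1n.
have zNE : z ^+ (t * N) = z ^+ (t * v) * z ^+ (t * (N - v)).
  by rewrite -exprD -mulnDr subnKC.
have z_norm1 : `|z| = 1.
  apply/eqP; rewrite -(@pexpr_eq1 _ _ N) ?(prim_order_gt0 zP) //.
  by rewrite -normrX (prim_expr_order zP) normr1.
have zV : Num.conj (z ^+ (t * v)) * z ^+ (t * v) = 1.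
  by rewrite mulrC -normCK normrX z_norm1 !expr1n.
by rewrite -[LHS]mulr1 -zN1 zNE mulrA zV mul1r.
Qed.

(** The contribution of one summand of [J] to its transform at [u].  The three
    terms of the expanded square have frequencies [u], [N - v + u] and [u + v];
    the bound [u + v < N] makes the first and last divisible by [N] only when
    they vanish, and the middle one only when [u = v]. *)
Lemma sum_sqr_norm_prim_root (C : numClosedFieldType) (N : nat) (z r a : C)
    (u v : nat) :
  N.-primitive_root z -> r \is Num.real -> (u + v < N)%N ->
  \sum_(1 <= t < N.+1) `|a + r * z ^+ (t * v)| ^+ 2 * z ^+ (t * u)
  = N%:R * ((`|a| ^+ 2 + r ^+ 2) *+ (u == 0%N) + r * a *+ (u == v)
            + r * Num.conj a *+ ((u == 0%N) && (v == 0%N))).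
Proof.
move=> zP r_real uvN.
have vN : (v < N)%N by apply: leq_ltn_trans uvN; exact: leq_addl.
have uN : (u < N)%N by apply: leq_ltn_trans uvN; exact: leq_addr.
have expand t : `|a + r * z ^+ (t * v)| ^+ 2 * z ^+ (t * u)
    = (`|a| ^+ 2 + r ^+ 2) * z ^+ (t * u) + r * a * z ^+ (t * (N - v + u))
      + r * Num.conj a * z ^+ (t * (u + v)).
  have zzc : z ^+ (t * v) * z ^+ (t * (N - v)) = 1.
    by rewrite -exprD -mulnDr subnKC ?(ltnW vN) // mulnC exprM
               (prim_expr_order zP) expr1n.
  rewrite !normCK rmorphD rmorphM /= (CrealP r_real).
  rewrite (conj_prim_root_expr _ _ _ _ _ zP (ltnW vN)) !mulnDr !exprD.
  ring: zzc.
rewrite (eq_bigr _ (fun t _ => expand t)) !big_split /= -!mulr_sumr.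
rewrite !sum_prim_root_expr //.
have dvd_small k : (k < N)%N -> (N %| k)%N = (k == 0%N).
  by case: k => [|k] kN; rewrite ?dvdn0 // gtnNdvd.
have -> : (N %| N - v + u)%N = (u == v).
  rewrite addnBAC ?(ltnW vN) // -eqn_mod_dvd ?modnDl ?modn_small //.
  exact: leq_trans (ltnW vN) (leq_addr _ _).
by rewrite !dvd_small // addn_eq0; do !case: eqP => _ /=; ring.
Qed.

Lemma cexpD (K : realType) (x y : K[i]) : cexp (x + y) = cexp x * cexp y.
Proof.
case: x y => [a b] [c d]; rewrite /cexp /= expRD cosD sinD.
by apply/eqP; rewrite eq_complex /=; apply/andP; split; apply/eqP; ring.
Qed.

Lemma cexp_mul_natr (K : realType) (x : K[i]) (n : nat) :
  cexp (x * n%:R) = cexp x ^+ n.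
Proof.
elim: n => [|n IHn].
  by rewrite mulr0 expr0 /cexp /= expR0 cos0 sin0 mulr1 mulr0.
by rewrite -natr1 mulrDr mulr1 cexpD IHn exprSr.
Qed.

Lemma cexp_imaginary (K : realType) (x : K) : cexp ('i%C * x%:C) = cos x +i* sin x.
Proof.
by rewrite /cexp /= !mul0r !mul1r !sub0r oppr0 expR0 !mul1r add0r.
Qed.

(** The half-angle formula [cos x = 1 - 2 sin (x / 2) ^ 2] settles this, as
    [sin] is positive on [(0, pi)]. *)
Lemma cos_lt1 (K : realType) (x : K) : 0 < x < 2 * pi -> cos x < 1.
Proof.
move=> /andP[x_gt0 x_lt].
have -> : x = (x / 2) *+ 2 by rewrite -mulr_natr divfK ?pnatr_eq0.
have : 0 < sin (x / 2) by apply: sin_gt0_pi; apply/andP; split; lra.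
have := cos2Dsin2 (x / 2); rewrite cos_mulr2n; nra.
Qed.

Lemma cexp_prim_root (K : realType) (N : nat) :
  (0 < N)%N -> N.-primitive_root (cexp ('i%C * (2 * pi / N%:R : K)%:C)).
Proof.
move=> N_gt0; set z := cexp _.
have N_neq0 : N%:R != 0 :> K by rewrite pnatr_eq0 -lt0n.
have zE k : z ^+ k = cos (2 * pi / N%:R * k%:R) +i* sin (2 * pi / N%:R * k%:R).
  by rewrite -cexp_imaginary -cexp_mul_natr [in RHS]rmorphM /= rmorph_nat mulrA.
have zN1 : z ^+ N = 1.
  by rewrite zE divfK // mulrC mulr_natr cos2pi sin2pi.
(* z is primitive of some order m dividing N, and m < N would put the angle
   2 pi m / N strictly between 0 and 2 pi with cosine 1 *)
have [m m_prim m_dvd] := prim_order_exists N_gt0 zN1.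
have [<- //|m_neqN] := eqVneq m N.
have m_ltN : (m < N)%N by rewrite ltn_neqAle m_neqN dvdn_leq.
have m_gt0 := prim_order_gt0 m_prim.
have : cos (2 * pi / N%:R * m%:R) < 1 :> K.
  apply: cos_lt1; rewrite mulr_gt0 ?divr_gt0 ?mulr_gt0 ?pi_gt0 ?ltr0n //=.
  by rewrite mulrAC ltr_pdivrMr ?ltr0n // ltr_pM2l ?mulr_gt0 ?pi_gt0 ?ltr0n // ltr_nat.
have := prim_expr_order m_prim; rewrite zE => -[-> _].
by rewrite ltxx.
Qed.

Theorem proposition5 (K : realType) (N : nat) (R : K) (A : nat -> K[i])
    (N_gt0 : (0 < N)%N) (N_even : ~~ odd N) (R_gt0 : 0 < R) :
  let w : K[i] := (2 * pi / N%:R)%:C in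
  let J : nat -> K[i] := fun tau =>
    \sum_(0 <= u < N./2) `|A u + R%:C * cexp ('i%C * w * tau%:R * u%:R)| ^+ 2 in
  let a : nat -> K[i] := fun u =>
    IFFT N J u * cexp ('i%C * w * (u%:R - 1)) in
  ((forall u : nat, (0 < u <= N./2 - 1)%N ->
      A u = (N%:R * R%:C)^-1 *
        \sum_(1 <= tau < N.+1) J tau * cexp ('i%C * w * tau%:R * u%:R))
   /\ `|A 0%N + R%:C| ^+ 2 =
      (N%:R)^-1 * \sum_(1 <= tau < N.+1) J tau
      - (\sum_(1 <= u1 < N./2) `|A u1| ^+ 2 + \sum_(1 <= u1 < N./2) R%:C ^+ 2))
  /\
  ((forall u : nat, (1 <= u <= N./2 - 1)%N -> A u = (R%:C)^-1 * a u.+1)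
   /\ `|A 0%N + R%:C| ^+ 2 =
      (N%:R)^-1 * \sum_(1 <= tau < N.+1) J tau
      - (\sum_(1 <= u1 < N./2) `|A u1| ^+ 2 + \sum_(1 <= u1 < N./2) R%:C ^+ 2)).
Proof.
move=> w J a.
have zP := cexp_prim_root K N N_gt0; rewrite -/w in zP.
set z := cexp ('i%C * w) in zP.
have NE : N = (N./2).*2 by rewrite -[LHS]odd_double_half (negPf N_even).
have m_gt0 : (0 < N./2)%N by rewrite half_gt0; case: (N) N_gt0 N_even => [|[]].
have N_neq0 : N%:R != 0 :> K[i] := prim_root_natf_neq0 zP.
have R_neq0 : R%:C != 0 :> K[i] by rewrite eq_complex /= eqxx andbT gt_eqF.
have R_real : R%:C \is Num.real by rewrite complex_real.
have expE t u : cexp ('i%C * w * t%:R * u%:R) = z ^+ (t * u).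
  by rewrite -mulrA -natrM cexp_mul_natr.
have transform u : (u < N./2)%N ->
    \sum_(1 <= t < N.+1) J t * z ^+ (t * u)
    = \sum_(0 <= v < N./2)
        N%:R * ((`|A v| ^+ 2 + R%:C ^+ 2) *+ (u == 0%N) + R%:C * A v *+ (u == v)
                + R%:C * Num.conj (A v) *+ ((u == 0%N) && (v == 0%N))).
  move=> um; under eq_bigr do rewrite mulr_suml.
  rewrite exchange_big /=; apply: eq_big_nat => v /andP[_ vm].
  under eq_bigr do rewrite expE.
  apply: sum_sqr_norm_prim_root => //.
  by rewrite [X in (_ < X)%N]NE -addnn; lia.
have coefficient u : (0 < u <= N./2 - 1)%N ->
    \sum_(1 <= t < N.+1) J t * z ^+ (t * u) = N%:R * R%:C * A u.
  move=> /andP[u_gt0 u_le]; have um : (u < N./2)%N by lia.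
  rewrite transform // (gtn_eqF u_gt0) big_mkord (bigD1 (Ordinal um)) //= eqxx.
  rewrite big1 => [|v v_neq]; first by rewrite mulr0n mulr1n add0r !addr0 mulrA.
  have /negPf -> : u != v by move: v_neq; rewrite -val_eqE eq_sym.
  by rewrite !mulr0n !addr0 mulr0.
have mean : `|A 0%N + R%:C| ^+ 2 = (N%:R)^-1 * \sum_(1 <= t < N.+1) J t
      - (\sum_(1 <= v < N./2) `|A v| ^+ 2 + \sum_(1 <= v < N./2) R%:C ^+ 2).
  have -> : \sum_(1 <= t < N.+1) J t = \sum_(1 <= t < N.+1) J t * z ^+ (t * 0).
    by apply: eq_bigr => t _; rewrite muln0 expr0 mulr1.
  rewrite transform // -mulr_sumr mulKf // (big_ltn m_gt0) /= -big_split /=.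
  have -> : \sum_(1 <= v < N./2) ((`|A v| ^+ 2 + R%:C ^+ 2) *+ 1
        + R%:C * A v *+ (0 == v)%N + R%:C * Num.conj (A v) *+ (v == 0)%N)
      = \sum_(1 <= v < N./2) (`|A v| ^+ 2 + R%:C ^+ 2).
    by apply: eq_big_nat => -[|v] //= _; rewrite !addr0.
  by rewrite addrK !normCK rmorphD /= (CrealP R_real); ring.
split; split=> // u u_bd.
  under eq_bigr do rewrite expE.
  by rewrite coefficient // mulKf // mulf_neq0.
have -> : a u.+1 = (N%:R)^-1 * \sum_(1 <= t < N.+1) J t * z ^+ (t * u).
  rewrite /a /IFFT -/w -(mulrA N%:R^-1) mulr_suml; congr (_ * _).
  apply: eq_bigr => t _; rewrite -expE -(mulrA (J t)) -cexpD; congr (_ * cexp _).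
  by rewrite -natr1; ring.
by rewrite coefficient // -mulrA mulKf // mulKf.
Qed.
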